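(* Let $U\subseteq\mathbf{R}^d$ be open, $\tau>0$ and $\sigma>1$. Let $\mathcal{E}_{\tau,\sigma}(U)$ denote either $\mathcal{E}_{\{\tau,\sigma\}}(U)$ or $\mathcal{E}_{(\tau,\sigma)}(U)$. Then $\mathcal{E}_{\tau,\sigma}(U)$ is closed under pointwise multiplication and under finite order differentiation; that is, if $\phi,\psi\in\mathcal{E}_{\tau,\sigma}(U)$ and $\beta\in\mathbf{N}^d$, then $\phi\psi\in\mathcal{E}_{\tau,\sigma}(U)$ and $\partial^\beta\phi\in\mathcal{E}_{\tau,\sigma}(U)$.
   Context: $\mathbf{N}$ denotes the nonnegative integers. For a compact set $K\subset U$ (with smooth boundary), $\tau>0$, $\sigma>1$ and $h>0$, $\mathcal{E}_{\tau,\sigma,h}(K)$ is the Banach space of smooth functions $\phi$ on $K$ with finite norm $$\|\phi\|_{\mathcal{E}_{\tau,\sigma,h}(K)}=\sup_{\alpha\in\mathbf{N}^d}\sup_{x\in K}\frac{|\partial^\alpha\phi(x)|}{h^{|\alpha|^\sigma}|\alpha|^{\tau|\alpha|^\sigma}},$$ where $|\alpha|^{\tau|\alpha|^{\sigma}}$ is read as $1$ for $\alpha=0$. The Roumieu class $\mathcal{E}_{\{\tau,\sigma\}}(U)=\varprojlim_{K\subset\subset U}\varinjlim_{h\to\infty}\mathcal{E}_{\tau,\sigma,h}(K)$ consists of the $\phi\in C^\infty(U)$ such that for every compact $K\subset U$ there is $h>0$ with $\|\phi\|_{\mathcal{E}_{\tau,\sigma,h}(K)}<\infty$. The Beurling class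 $\mathcal{E}_{(\tau,\sigma)}(U)=\varprojlim_{K\subset\subset U}\varprojlim_{h\to0}\mathcal{E}_{\tau,\sigma,h}(K)$ consists of the $\phi\in C^\infty(U)$ such that $\|\phi\|_{\mathcal{E}_{\tau,\sigma,h}(K)}<\infty$ for every compact $K\subset U$ and every $h>0$. *)

(* Defs.v *)
From HB Require Import structures.
From mathcomp Require Import all_boot all_order all_algebra.
From mathcomp Require Import complex.
From mathcomp Require Import all_classical all_reals all_analysis.

Set Implicit Arguments.
Unset Strict Implicit.
Unset Printing Implicit Defensive.

Import Order.TTheory GRing.Theory Num.Theory.
Import numFieldNormedType.Exports.

Local Open Scope classical_set_scope.
Local Open Scope ring_scope.

(* [Rcomplex R] is the library's alias of the complex numbers [R[i]] carrying
   the R-module structure and the R-valued modulus; here it receives the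
   topology of that modulus, so that ['D_v f] and [derivable] apply to
   complex-valued functions of real variables. *)
Section Rcomplex_normedModType.
Variable R : realType.

Lemma Rcomplex_normrZ (l : R) (z : Rcomplex R) : `|l *: z| = `|l| * `|z|.
Proof.
case: z => a b; rewrite /Num.norm /= /Normc.normc /=.
by rewrite !exprMn -mulrDr sqrtrM ?sqr_ge0// sqrtr_sqr.
Qed.

HB.instance Definition _ := isPointed.Build (Rcomplex R) 0.
HB.instance Definition _ :=
  PseudoMetric.copy (Rcomplex R) (pseudoMetric_normed (Rcomplex R)).
HB.instance Definition _ :=
  NormedZmod_PseudoMetric_eq.Build R (Rcomplex R) erefl.
HB.instance Definition _ :=
  PseudoMetricNormedZmod_Lmodule_isNormedModule.Build R (Rcomplex R)
    Rcomplex_normrZ.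

End Rcomplex_normedModType.

Section PartialDerivatives.
Context {R : realType} {d : nat} {W : normedModType R}.
Implicit Types (f : 'rV[R]_d -> W) (U : set 'rV[R]_d) (a : 'I_d -> nat).

Definition pderiv (i : 'I_d) f : 'rV[R]_d -> W := 'D_(delta_mx 0 i) f.

Definition pderivs (s : seq 'I_d) f : 'rV[R]_d -> W := foldr pderiv f s.

(* For smooth f the order of differentiation is immaterial (Schwarz); the
   word below fixes one. *)
Definition mderiv a f : 'rV[R]_d -> W :=
  pderivs (flatten [seq nseq (a i) i | i <- enum 'I_d]) f.

(* A function on U is represented by a total function whose values outside U
   are irrelevant: U being open, derivatives at points of U only depend on the
   restriction to U. *)
Definition smooth_on U f : Prop :=
  (forall s x, U x -> {for x, continuous (pderivs s f)}) /\
  (forall s i x, U x -> derivable (pderivs s f) x (delta_mx 0 i)).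

End PartialDerivatives.

Section UltradifferentiableClasses.
Context {R : realType} {d : nat}.
Implicit Types (phi : 'rV[R]_d -> Rcomplex R) (K U : set 'rV[R]_d).
Implicit Types (a : 'I_d -> nat) (tau sigma h : R).

Definition mlength a : nat := \sum_(i < d) a i.

(* At n = 0 and sigma <> 0 this is 1, since [0 `^ sigma = 0], [x `^ 0 = 1] and
   in particular [0 `^ 0 = 1]. *)
Definition ultra_weight tau sigma h (n : nat) : R :=
  h `^ (n%:R `^ sigma) * n%:R `^ (tau * n%:R `^ sigma).

(* The value for empty K is -oo rather than 0, which is also finite in the
   sense [< +oo] used below. *)
Definition ultra_norm tau sigma h K phi : \bar R :=
  ereal_sup [set (`|mderiv a phi x| / ultra_weight tau sigma h (mlength a))%:E
            | a in [set: 'I_d -> nat] & x in K].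

Definition roumieu tau sigma U : set ('rV[R]_d -> Rcomplex R) :=
  [set phi | smooth_on U phi /\
    forall K, compact K -> K `<=` U ->
      exists2 h, 0 < h & (ultra_norm tau sigma h K phi < +oo)%E].

Definition beurling tau sigma U : set ('rV[R]_d -> Rcomplex R) :=
  [set phi | smooth_on U phi /\
    forall K, compact K -> K `<=` U ->
      forall h, 0 < h -> (ultra_norm tau sigma h K phi < +oo)%E].

End UltradifferentiableClasses.

(* Main.v *)
Require Import Defs.
From mathcomp Require Import all_boot all_order all_algebra.
From mathcomp Require Import complex.
From mathcomp Require Import all_classical all_reals all_analysis.
From mathcomp Require Import ring zify.
Set Implicit Arguments.
Unset Strict Implicit.
Unset Printing Implicit Defensive.

Import Order.TTheory GRing.Theory Num.Theory.
Import numFieldNormedType.Exports.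
Local Open Scope classical_set_scope.
Local Open Scope ring_scope.

(** Both classes are controlled by one two-parameter weight
    W_h(n) = h^(n^sigma) n^(tau n^sigma), and the two claims come down to two
    inequalities for it, in which the loss is always absorbed by h:
    - 2^(k+l) W_h(k) W_h(l) <= W_g(k+l) with g = 2 max(h^(2^-sigma), h)
      ([ultra_weightM]);
    - W_h(n+1) <= max(1,h) W_g(n) with g = B max(h, h^(2^sigma)), where B
      depends on tau and sigma only ([ultra_weightS]).
    In both cases g is finite for each h, which is what the Roumieu class
    needs, and g can be made smaller than any prescribed positive number by
    taking h small ([max_powR_small]), which is what the Beurling class needs.

    It remains to reduce the claims to these inequalities.  Derivatives are
    indexed by words in the coordinates, along which Leibniz' rule and
    composition of derivatives are immediate: a product derived along a word of
    length n is a sum of 2^n terms, one for each way of distributing the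
    letters between the two factors ([leibniz]), and deriving once more appends
    a letter.  The norms of the classes, on the other hand, see one word for
    each multi-index only.  The two points of view agree by Schwarz' theorem on
    mixed derivatives ([pderivs_perm]), proved by applying the mean value
    theorem twice to a second difference; for complex values it follows by
    taking real and imaginary parts.  Hence a norm is finite if and only if all
    words satisfy the same bound ([ultra_norm_lty]). *)

(** * Inequalities for the weights *)

Section Weights.
Context {R : realType}.
Implicit Types (x y h g c N A tau sigma : R) (k l n : nat).

Lemma le_powR2r x y c : 0 <= c -> 0 <= x -> x <= y -> x `^ c <= y `^ c.
Proof.
by move=> c0 x0 xy; apply: ge0_ler_powR; rewrite ?nnegrE// (le_trans x0).
Qed.

Definition max_powR (c1 c2 h : R) : R := Num.max (h `^ c1) (h `^ c2).

Lemma max_powR_gt0 c1 c2 h : 0 < h -> 0 < max_powR c1 c2 h.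
Proof. by move=> h0; rewrite /max_powR lt_max powR_gt0. Qed.

Lemma max_powR_ge0 c1 c2 h : 0 <= max_powR c1 c2 h.
Proof. by rewrite /max_powR le_max powR_ge0. Qed.

(** An exponent known only up to the factors c1 and c2 costs a change of base:
    the larger power is extremal if h >= 1, the smaller one otherwise. *)
Lemma powR_le_max_powR c1 c2 h N A : 0 < h -> 0 <= N ->
  c1 * N <= A <= c2 * N -> h `^ A <= max_powR c1 c2 h `^ N.
Proof.
move=> h0 N0 /andP[lA uA].
have [h1|h1] := leP 1 h.
  apply: (le_trans (ler_powR h1 uA)); rewrite powRrM.
  by apply: le_powR2r; rewrite ?powR_ge0// /max_powR le_max lexx orbT.
have h01 : 0 < h <= 1 by rewrite h0 ltW.
apply: (le_trans (ger_powR h01 lA)); rewrite powRrM.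
by apply: le_powR2r; rewrite ?powR_ge0// /max_powR le_max lexx.
Qed.

(** For h <= 1 the smaller exponent c1 gives the maximum, which tends to 0 with h
    because c1 > 0. *)
Lemma max_powR_small c1 c2 B g : 0 < c1 <= c2 -> 0 < B -> 0 < g ->
  exists2 h, 0 < h & B * max_powR c1 c2 h <= g.
Proof.
move=> /andP[c0 c12] B0 g0.
exists (Num.min 1 ((g / B) `^ c1^-1)).
  by rewrite lt_min ltr01 powR_gt0// divr_gt0.
set h := Num.min _ _.
have h0 : 0 < h by rewrite lt_min ltr01 powR_gt0// divr_gt0.
have h1 : h <= 1 by rewrite ge_min lexx.
have -> : max_powR c1 c2 h = h `^ c1.
  by apply/max_idPl; apply: ger_powR; rewrite ?h0.
rewrite mulrC -ler_pdivlMr//.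
have gB : 0 <= g / B by rewrite divr_ge0 ?ltW.
rewrite -[leRHS](powRr1 gB) -(@mulVf _ c1) ?gt_eqF// powRrM.
by apply: le_powR2r; rewrite ?invr_ge0 ?(ltW c0) ?(ltW h0)// /h ge_min lexx orbT.
Qed.

Lemma ultra_weight0 tau sigma h : sigma != 0 -> ultra_weight tau sigma h 0 = 1.
Proof. by move=> s0; rewrite /ultra_weight powR0// mulr0 !powRr0 mulr1. Qed.

Lemma ultra_weight_gt0 tau sigma h n : sigma != 0 -> 0 < h ->
  0 < ultra_weight tau sigma h n.
Proof.
move=> s0 h0; case: n => [|n]; first by rewrite ultra_weight0.
by rewrite mulr_gt0// powR_gt0// ltr0n.
Qed.

Lemma ultra_weight_le tau sigma h g n : 0 <= h -> h <= g ->
  ultra_weight tau sigma h n <= ultra_weight tau sigma g n.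
Proof.
move=> h0 hg; rewrite ler_wpM2r ?powR_ge0//.
by apply: le_powR2r; rewrite ?powR_ge0.
Qed.

(** Both terms are of the form x x^(p-1), and x^(p-1), y^(p-1) <= (x+y)^(p-1). *)
Lemma powR_superadditive x y p : 0 <= x -> 0 <= y -> 1 <= p ->
  x `^ p + y `^ p <= (x + y) `^ p.
Proof.
move=> x0 y0 p1; have p0 : 0 < p by apply: lt_le_trans p1.
rewrite -(mulr_powRB1 x0 p0) -(mulr_powRB1 y0 p0) -(mulr_powRB1 (addr_ge0 x0 y0) p0).
have xy := addr_ge0 x0 y0.
rewrite mulrDl lerD// ler_wpM2l//; apply: le_powR2r;
  by rewrite ?subr_ge0// ?lerDl ?lerDr.
Qed.

(** The larger of x and y is at least half of their sum. *)
Lemma powR_half_le_add x y p : 0 <= x -> 0 <= y -> 0 <= p ->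
  2 `^ (- p) * (x + y) `^ p <= x `^ p + y `^ p.
Proof.
have wl a b : 0 <= a -> a <= b -> 0 <= p ->
    2 `^ (- p) * (a + b) `^ p <= a `^ p + b `^ p.
  move=> a0 ab p0; have b0 := le_trans a0 ab.
  have ab0 := addr_ge0 a0 b0.
  apply: (@le_trans _ _ (b `^ p)); last by rewrite lerDr powR_ge0.
  have -> : 2 `^ (- p) = 2^-1 `^ p :> R.
    by rewrite -[2^-1]powR_inv1// -powRrM mulN1r.
  rewrite -powRM ?invr_ge0//; apply: le_powR2r => //.
    by rewrite mulr_ge0 ?invr_ge0.
  by rewrite mulrC ler_pdivrMr// mulr_natr mulr2n lerD2r.
move=> x0 y0; have [xy|/ltW yx] := leP x y; first exact: wl.
by rewrite (addrC x) (addrC (x `^ p)); exact: wl.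
Qed.

Lemma natr_le_powR n p : 1 <= p -> n%:R <= n%:R `^ p :> R.
Proof.
case: n => [|n] p1; first exact: powR_ge0.
by apply: le1r_powR; rewrite ?ler1n.
Qed.

(** Superadditivity of t^sigma bounds the powers of k and l by one of k + l.
    The powers of h have the total exponent k^sigma + l^sigma, which lies
    between 2^-sigma (k+l)^sigma and (k+l)^sigma. The factor 2^(k+l), the number
    of terms in Leibniz' rule, is at most 2^((k+l)^sigma). *)
Lemma ultra_weightM tau sigma h k l : 0 <= tau -> 1 <= sigma -> 0 < h ->
  2 ^+ (k + l) * (ultra_weight tau sigma h k * ultra_weight tau sigma h l) <=
  ultra_weight tau sigma (2 * max_powR (2 `^ (- sigma)) 1 h) (k + l).
Proof.
move=> t0 s1 h0.
have s0 : sigma != 0 by rewrite gt_eqF// (lt_le_trans _ s1).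
have [/eqP|n0] := posnP (k + l).
  rewrite addn_eq0 => /andP[/eqP-> /eqP->].
  by rewrite !ultra_weight0// !mulr1 expr0.
have sup := powR_superadditive (ler0n R k) (ler0n R l) s1.
have inf := powR_half_le_add (ler0n R k) (ler0n R l) (le_trans ler01 s1).
rewrite -natrD in sup inf.
rewrite /ultra_weight mulrACA -powRD; last by rewrite (gt_eqF h0) implybT.
rewrite (mulrA (2 ^+ _)); apply: ler_pM; rewrite ?mulr_ge0 ?exprn_ge0 ?powR_ge0//.
  rewrite powRM ?max_powR_ge0//; apply: ler_pM; rewrite ?exprn_ge0 ?powR_ge0//.
    by rewrite -powR_mulrn// ler_powR ?ler1n ?natr_le_powR.
  by apply: powR_le_max_powR; rewrite ?powR_ge0// mul1r inf sup.
have n1 : 1 <= (k + l)%:R :> R by rewrite ler1n.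
apply: le_trans (ler_powR n1 (ler_wpM2l t0 sup)).
rewrite mulrDr powRD; last by rewrite (gt_eqF (lt_le_trans ltr01 n1)) implybT.
by apply: ler_pM; rewrite ?powR_ge0//; apply: le_powR2r;
  rewrite ?mulr_ge0 ?powR_ge0// ler_nat ?leq_addr ?leq_addl.
Qed.

(** With q = 1 + 1/n one has q^sigma <= exp(sigma/n) <= 1 + sigma e^sigma / n,
    and the gain 1/n compensates the factor ln (n+1) <= n; hence the logarithms
    of consecutive weights differ by O(n^sigma) only. *)
Lemma powR_ln_succ_le sigma n : 0 <= sigma -> (0 < n)%N ->
  n.+1%:R `^ sigma * ln n.+1%:R <=
  n%:R `^ sigma * (ln n%:R + (1 + sigma * expR sigma)) :> R.
Proof.
move=> s0 n0; have n0R : 0 < n%:R :> R by rewrite ltr0n.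
have nS : n.+1%:R = n%:R * (1 + n%:R^-1) :> R.
  by rewrite mulrDr mulr1 divff ?gt_eqF// -natr1.
have i0 : 0 < n%:R^-1 :> R by rewrite invr_gt0.
have i1 : n%:R^-1 <= 1 :> R by rewrite invf_le1// ler1n.
have q0 : 0 < 1 + n%:R^-1 :> R by rewrite addr_gt0.
have lnq : ln (1 + n%:R^-1) <= n%:R^-1 :> R.
  by rewrite -[leRHS]expRK ler_ln ?posrE ?expR_gt0// expR_ge1Dx.
have lnS : ln n.+1%:R <= n%:R :> R.
  by rewrite -[leRHS]expRK ler_ln ?posrE ?expR_gt0 ?ltr0n// -nat1r expR_ge1Dx.
have lnS0 : 0 <= ln n.+1%:R :> R by rewrite ln_ge0// ler1n.
have rat : (1 + n%:R^-1) `^ sigma <= 1 + sigma * expR sigma / n%:R :> R.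
  set y : R := sigma / n%:R.
  have y0 : 0 <= y by rewrite divr_ge0.
  have ys : y <= sigma by rewrite ler_piMr.
  apply: (@le_trans _ _ (expR y)).
    by rewrite /powR gt_eqF// ler_expR ler_wpM2l.
  rewrite mulrAC -/y -lerBlDl.
  apply: (@le_trans _ _ (y * expR y)); last by rewrite ler_wpM2l ?ler_expR.
  (* exp(y) - 1 <= y exp(y) is 1 - y <= exp(-y) multiplied by exp(y) *)
  have := ler_wpM2r (expR_ge0 y) (expR_ge1Dx (- y)).
  by rewrite -expRD addNr expR0 mulrDl mul1r mulNr lerBlDr -lerBlDl.
have lnq' : ln n.+1%:R <= ln n%:R + 1 :> R.
  rewrite nS lnM ?posrE// lerD2l; exact: le_trans i1.
rewrite {1}nS powRM ?(ltW q0)// -mulrA ler_wpM2l ?powR_ge0//.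
apply: (le_trans (ler_wpM2r lnS0 rat)).
rewrite mulrDl mul1r addrA lerD// -(mulrA (sigma * _)).
rewrite ler_piMr ?mulr_ge0 ?expR_ge0//.
by rewrite mulrC ler_pdivrMr// mul1r.
Qed.

(** With D the constant of [powR_ln_succ_le], this is e^(tau D), the part of the
    change of base that does not depend on h. *)
Definition shift_factor tau sigma : R := expR (tau * (1 + sigma * expR sigma)).

(** The case n = 0, where n^sigma vanishes and so g has no effect, is the only
    one that needs the constant max(1,h). *)
Lemma ultra_weightS tau sigma h n : 0 <= tau -> 0 < sigma -> 0 < h ->
  ultra_weight tau sigma h n.+1 <=
  Num.max 1 h * ultra_weight tau sigma
     (shift_factor tau sigma * max_powR 1 (2 `^ sigma) h) n.
Proof.
move=> t0 s0 h0.
case: n => [|n].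
  rewrite ultra_weight0 ?gt_eqF// mulr1 /ultra_weight !powR1 powRr1 ?(ltW h0)//.
  by rewrite mulr1 le_max lexx orbT.
set m := n.+1; set g := _ * max_powR _ _ _.
have e0 := expR_ge0 (tau * (1 + sigma * expR sigma)).
apply: (@le_trans _ _ (ultra_weight tau sigma g m)); last first.
  by rewrite ler_peMl ?le_max ?lexx// /ultra_weight mulr_ge0 ?powR_ge0.
rewrite /ultra_weight /g (powRM _ (expR_ge0 _)) ?max_powR_ge0//.
rewrite [_ `^ _ * max_powR _ _ _ `^ _]mulrC -mulrA.
apply: ler_pM; rewrite ?powR_ge0//.
  apply: powR_le_max_powR; rewrite ?powR_ge0// mul1r; apply/andP; split.
    by apply: le_powR2r; rewrite ?(ltW s0)// ler_nat.
  rewrite -powRM//; apply: le_powR2r; rewrite ?mulr_ge0 ?(ltW s0)//.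
  by rewrite -natrM ler_nat /m; lia.
have := ler_wpM2l t0 (powR_ln_succ_le (ltW s0) (ltn0Sn n)).
rewrite /shift_factor /powR !gt_eqF ?expR_gt0 ?ltr0n// expRK -expRD ler_expR.
rewrite -mulrA => /le_trans; apply.
by rewrite le_eqVlt; apply/orP; left; apply/eqP; ring.
Qed.

End Weights.

(** * Symmetry of mixed directional derivatives *)

Section MixedDerivatives.
Context {R : realType} {V : normedModType R}.
Implicit Types (f : V -> R) (x u v w : V).

Lemma is_derive_line (W : normedModType R) (f : V -> W) x v (s : R) :
  derivable f (x + s *: v) v ->
  is_derive s 1 (fun r : R => f (x + r *: v)) ('D_v f (x + s *: v)).
Proof.
move=> df.
have E : (fun h : R => h^-1 *: (f (x + (h *: 1 + s) *: v) - f (x + s *: v)))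
       = (fun h : R => h^-1 *: (f (h *: v + (x + s *: v)) - f (x + s *: v))).
  apply/funext => h; congr (_ *: (f _ - _)).
  by rewrite scalerDl [h *: 1]mulr1 addrCA.
by apply: DeriveDef; rewrite /derivable /derive /= E.
Qed.

Lemma MVT_line f x v (t : R) : 0 < t ->
  (forall s, 0 <= s <= t -> derivable f (x + s *: v) v) ->
  exists2 s, 0 <= s <= t & f (x + t *: v) - f x = 'D_v f (x + s *: v) * t.
Proof.
move=> t0 df.
have [||s] := @MVT_segment R (fun r => f (x + r *: v))
  (fun r => 'D_v f (x + r *: v)) 0 t (ltW t0).
- move=> s; rewrite in_itv/= => /andP[s0 st].
  by apply: is_derive_line; apply: df; rewrite !ltW.
- apply: derivable_within_continuous => s; rewrite in_itv/= => s0t.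
  by have [] := is_derive_line (df _ s0t).
- by rewrite in_itv/= subr0 scale0r addr0; exists s.
Qed.

Lemma is_derive_translate (W : normedModType R) (f : V -> W) x v w :
  derivable f (x + w) v ->
  is_derive x v (fun y => f (y + w)) ('D_v f (x + w)).
Proof.
move=> df.
have E : (fun h : R => h^-1 *: (f (h *: v + x + w) - f (x + w)))
       = (fun h : R => h^-1 *: (f (h *: v + (x + w)) - f (x + w))).
  by apply/funext => h; rewrite addrA.
by apply: DeriveDef; rewrite /derivable /derive /= E.
Qed.

(** The second difference is a first difference in direction u of
    y |-> f (y + t v) - f y; the mean value theorem turns it into a difference
    of 'D_u f in direction v, to which it applies again. *)
Lemma second_difference f x u v (t : R) : 0 < t ->
  (forall r s, 0 <= r <= t -> 0 <= s <= t ->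
     derivable f (x + r *: u + s *: v) u /\
     derivable ('D_u f) (x + r *: u + s *: v) v) ->
  exists r s, [/\ 0 <= r <= t, 0 <= s <= t &
    f (x + t *: u + t *: v) - f (x + t *: u) - (f (x + t *: v) - f x) =
    'D_v ('D_u f) (x + r *: u + s *: v) * t * t].
Proof.
move=> t0 df.
have tt : 0 <= t <= t by rewrite lexx (ltW t0).
have zt : (0 : R) <= 0 <= t by rewrite (ltW t0) andbT lexx.
pose g y := f (y + t *: v) - f y.
have dg r : 0 <= r <= t -> is_derive (x + r *: u) u g
    ('D_u f (x + r *: u + t *: v) - 'D_u f (x + r *: u)).
  move=> rt; apply: is_deriveB.
    by apply: is_derive_translate; have [] := df _ _ rt tt.
  by apply: derivableP; have [] := df _ _ rt zt; rewrite scale0r addr0.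
have [r|r rt gr] := @MVT_line g x u t t0.
  by move=> /dg[].
have [s|s st fs] := @MVT_line ('D_u f) (x + r *: u) v t t0.
  by move=> st; have [] := df _ _ rt st.
exists r, s; split=> //.
have := gr; rewrite (@derive_val _ _ _ _ _ _ _ (dg _ rt)) fs => <-.
by rewrite /g addrAC.
Qed.

(** The second difference is symmetric in u and v, so the two mixed derivatives
    take a common value at points as close to x as desired. *)
Lemma schwarz_real (U : set V) f x u v : open U -> U x ->
  (forall y, U y -> derivable f y u /\ derivable f y v) ->
  (forall y, U y -> derivable ('D_u f) y v /\ derivable ('D_v f) y u) ->
  {for x, continuous ('D_v ('D_u f))} ->
  {for x, continuous ('D_u ('D_v f))} ->
  'D_v ('D_u f) x = 'D_u ('D_v f) x.
Proof.
move=> oU Ux df d2f cvu cuv.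
apply/eqP; rewrite -subr_eq0 -normr_le0; apply/ler_addgt0Pl => e e0; rewrite addr0.
have e2 : 0 < e / 2 by rewrite divr_gt0.
have /cvgrPdist_lt/(_ _ e2) nvu := cvu.
have /cvgrPdist_lt/(_ _ e2) nuv := cuv.
have nU : nbhs x U by exact: open_nbhs_nbhs.
have /nbhs_ballP[r /= r0 rP] : nbhs x (U `&`
    ([set y | `|'D_v ('D_u f) x - 'D_v ('D_u f) y| < e / 2] `&`
     [set y | `|'D_u ('D_v f) x - 'D_u ('D_v f) y| < e / 2])).
  exact: (filterI nU (filterI nvu nuv)).
pose n : R := `|u| + `|v| + 1.
have n0 : 0 < n by rewrite ltr_wpDl ?addr_ge0.
(* points x + a u + b v with a, b <= t lie within t (|u| + |v|) < t n = r *)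
pose t := r / n.
have t0 : 0 < t by rewrite divr_gt0.
have near a b : 0 <= a <= t -> 0 <= b <= t -> ball x r (x + a *: u + b *: v).
  move=> /andP[a0 at_] /andP[b0 bt].
  rewrite -ball_normE /ball_ /= -addrA opprD addNKr normrN.
  apply: (le_lt_trans (ler_normD _ _)); rewrite !normrZ !ger0_norm//.
  have -> : r = t * n by rewrite /t divfK// gt_eqF.
  rewrite /n mulrDr mulr1 mulrDr.
  apply: (@le_lt_trans _ _ (t * `|u| + t * `|v|));
    [by rewrite lerD// ler_wpM2r|by rewrite ltrDl].
have [a [b [a0t b0t ab]]] := @second_difference f x u v t t0 (fun r s rt st =>
  conj (df _ (rP _ (near _ _ rt st)).1).1 (d2f _ (rP _ (near _ _ rt st)).1).1).
have near' a' b' : 0 <= a' <= t -> 0 <= b' <= t ->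
    ball x r (x + a' *: v + b' *: u) by move=> a't b't; rewrite addrAC; exact: near.
have [c [d [c0t d0t cd]]] := @second_difference f x v u t t0 (fun r s rt st =>
  conj (df _ (rP _ (near' _ _ rt st)).1).2 (d2f _ (rP _ (near' _ _ rt st)).1).2).
have eqD : 'D_v ('D_u f) (x + a *: u + b *: v) = 'D_u ('D_v f) (x + c *: v + d *: u).
  have tn0 : t != 0 by rewrite gt_eqF.
  have swap (p q p' q' : R) : p - q - (p' - q') = p - p' - (q - q').
    by rewrite !opprB addrACA [in RHS]addrACA [- q + _]addrC [- p' + _]addrC.
  have := ab; rewrite (addrAC x (t *: u)) swap cd.
  by move=> /(mulIf tn0) /(mulIf tn0) ->.
have [_ [/= h1 _]] := rP _ (near _ _ a0t b0t).
have [_ [_ /= h2]] := rP _ (near' _ _ c0t d0t).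
rewrite /= eqD in h1.
set p := 'D_u _ _ in h1 h2; rewrite (splitr e).
apply: (le_trans (ler_distD p _ _)); apply: lerD; first exact: (ltW h1).
by rewrite distrC; exact: (ltW h2).
Qed.

End MixedDerivatives.

(** * Complex-valued functions *)

Section ComplexValues.
Context {R : realType}.
Implicit Types z w : Rcomplex R.

Lemma Rcomplex_normM z w : `|z * w : Rcomplex R| = `|z| * `|w|.
Proof. exact: Normc.normcM. Qed.

Lemma ler_norm_Re z : `|complex.Re z| <= `|z|.
Proof.
case: z => a b; rewrite [leRHS]/Num.norm /= /Normc.normc.
by rewrite -sqrtr_sqr ler_sqrt ?lerDl ?addr_ge0 ?sqr_ge0.
Qed.

Lemma ler_norm_Im z : `|complex.Im z| <= `|z|.
Proof.
case: z => a b; rewrite [leRHS]/Num.norm /= /Normc.normc.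
by rewrite -sqrtr_sqr ler_sqrt ?lerDr ?addr_ge0 ?sqr_ge0.
Qed.

Lemma contraction_continuous (W W' : normedModType R) (l : {linear W -> W'}) :
  (forall y, `|l y| <= `|y|) -> continuous l.
Proof.
move=> lc y; apply/cvgrPdist_lt => e e0.
have /cvgrPdist_lt/(_ e e0) : id w @[w --> y] --> y by exact: cvg_id.
by apply: filterS => w yw; rewrite -linearB (le_lt_trans (lc _)).
Qed.

Lemma Re_continuous : continuous (@complex.Re R : Rcomplex R -> R).
Proof.
exact: (@contraction_continuous _ _
  (@complex.Re R : {linear Rcomplex R -> R}) ler_norm_Re).
Qed.

Lemma Im_continuous : continuous (@complex.Im R : Rcomplex R -> R).
Proof.
exact: (@contraction_continuous _ _
  (@complex.Im R : {linear Rcomplex R -> R}) ler_norm_Im).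
Qed.

Lemma Rcomplex_cvgM (T : Type) (F : set_system T) {FF : Filter F}
    (f g : T -> Rcomplex R) z w :
  f @ F --> z -> g @ F --> w ->
  (fun t => f t * g t : Rcomplex R) @ F --> (z * w : Rcomplex R).
Proof.
move=> fz gw; apply/subr_cvg0/norm_cvg0P.
have f0 : `|f t - z| @[t --> F] --> (0 : R) by apply/norm_cvg0P/subr_cvg0.
have g0 : `|g t - w| @[t --> F] --> (0 : R) by apply/norm_cvg0P/subr_cvg0.
have bound : `|f t - z| * `|g t| + `|z| * `|g t - w| @[t --> F] --> (0 : R).
  have -> : 0 = 0 * `|w| + `|z| * 0 :> R by rewrite mul0r mulr0 addr0.
  by apply: cvgD; apply: cvgM => //; [exact: cvg_norm|exact: cvg_cst].
apply: (@squeeze_cvgr _ F _ R (cst 0) _ _ _ 0 (cvg_cst (0 : R)) bound).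
apply: nearW => t /=; rewrite normr_ge0/= -!Rcomplex_normM.
have -> : f t * g t - z * w = (f t - z) * g t + z * (g t - w) :> Rcomplex R.
  by rewrite mulrBl mulrBr addrA subrK.
exact: ler_normD.
Qed.

Lemma is_derive_linear (V W W' : normedModType R) (l : {linear W -> W'})
    (f : V -> W) x v : continuous l -> derivable f x v ->
  is_derive x v (l \o f) (l ('D_v f x)).
Proof.
move=> lc df.
have cl : (fun h : R => h^-1 *: ((l \o f) (h *: v + x) - (l \o f) x)) @ 0^'
    --> l ('D_v f x).
  under eq_fun do rewrite /= -linearB -linearZ.
  by apply: continuous_cvg => //; exact: lc.
by apply: DeriveDef; [apply/cvg_ex; exists (l ('D_v f x))|exact: cvg_lim cl].
Qed.

Lemma is_derive_RcomplexM (V : normedModType R) (f g : V -> Rcomplex R) x v :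
  {for x, continuous g} -> derivable f x v -> derivable g x v ->
  is_derive x v (fun y => f y * g y : Rcomplex R)
    ('D_v f x * g x + f x * 'D_v g x).
Proof.
move=> gc df dg.
have line : (fun h : R => h *: v + x) @ 0^' --> x.
  have : h *: v + x @[h --> (0 : R)] --> 0 *: v + x.
    by apply: cvgD; [apply: cvgZr_tmp; exact: cvg_id|exact: cvg_cst].
  by rewrite scale0r add0r; exact: cvg_within_filter.
have cl : (fun h : R => h^-1 *:
      ((f (h *: v + x) * g (h *: v + x) : Rcomplex R) - f x * g x)) @ 0^' -->
    ('D_v f x * g x + f x * 'D_v g x : Rcomplex R).
  have E : (fun h : R => h^-1 *:
      ((f (h *: v + x) * g (h *: v + x) : Rcomplex R) - f x * g x)) =
    (fun h : R => (h^-1 *: (f (h *: v + x) - f x)) * g (h *: v + x) +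
                  f x * (h^-1 *: (g (h *: v + x) - g x)) : Rcomplex R).
    apply/funext => h; rewrite -scalerAl [f x * (_ *: _)]mulrC -scalerAl.
    rewrite [_ * f x]mulrC -scalerDr; congr (_ *: _).
    by rewrite mulrBl mulrBr addrA subrK.
  rewrite E; apply: cvgD; apply: Rcomplex_cvgM => //; last exact: cvg_cst.
  exact: cvg_comp line gc.
apply: DeriveDef; last exact: cvg_lim cl.
by apply/cvg_ex; eexists; exact: cl.
Qed.

End ComplexValues.

(** * Iterated partial derivatives on an open set *)

Section IteratedPartials.
Context {R : realType} {d : nat}.
Implicit Types (U : set 'rV[R]_d) (s t : seq 'I_d) (i j : 'I_d).

Lemma pderivs_cat (W : normedModType R) s t (f : 'rV[R]_d -> W) :
  pderivs (s ++ t) f = pderivs s (pderivs t f).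
Proof. exact: foldr_cat. Qed.

Lemma smooth_on_pderivs (W : normedModType R) U t (f : 'rV[R]_d -> W) :
  smooth_on U f -> smooth_on U (pderivs t f).
Proof.
by move=> [cf df]; split=> s *; rewrite -pderivs_cat; [exact: cf|exact: df].
Qed.

Lemma near_open (T : topologicalType) (O : set T) (P : T -> Prop) x :
  open O -> O x -> (forall y, O y -> P y) -> \forall y \near x, P y.
Proof. by move=> oO Ox OP; apply: filterS OP _; exact: open_nbhs_nbhs. Qed.

Lemma pderivs_eq_on (W : normedModType R) U (f g : 'rV[R]_d -> W) s : open U ->
  (forall x, U x -> f x = g x) -> forall x, U x -> pderivs s f x = pderivs s g x.
Proof.
move=> oU fg; elim: s => [|i s IH] x Ux; first exact: fg.
by apply: near_eq_derive; exact: near_open IH.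
Qed.

(** To prove smoothness it suffices to have candidates for all iterated
    derivatives: on an open set they may replace the derivatives in
    neighbourhoods of points. *)
Lemma smooth_on_of_eq_on (W : normedModType R) U (f : 'rV[R]_d -> W)
    (F : seq 'I_d -> 'rV[R]_d -> W) : open U ->
  (forall s x, U x -> pderivs s f x = F s x) ->
  (forall s x, U x -> {for x, continuous (F s)}) ->
  (forall s i x, U x -> derivable (F s) x (delta_mx 0 i)) ->
  smooth_on U f.
Proof.
move=> oU fF cF dF.
have nE s x : U x -> {near x, F s =1 pderivs s f}.
  by move=> Ux; apply: (@near_open _ U) => // y Uy; rewrite fF.
split=> [s x Ux|s i x Ux]; last exact: near_eq_derivable (nE s x Ux) (dF s i x Ux).
rewrite /prop_for /continuous_at fF//.
exact: (cvg_trans (near_eq_cvg (nE s x Ux)) (cF s x Ux)).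
Qed.

Lemma pderivs_linear (W W' : normedModType R) (l : {linear W -> W'}) U
    (f : 'rV[R]_d -> W) s : continuous l -> open U -> smooth_on U f ->
  forall x, U x -> pderivs s (l \o f) x = l (pderivs s f x).
Proof.
move=> lc oU [_ df]; elim: s => //= i s IH x Ux.
have -> : pderiv i (pderivs s (l \o f)) x = pderiv i (l \o pderivs s f) x.
  by apply: near_eq_derive; apply: near_open IH.
by have [] := is_derive_linear lc (df s i x Ux).
Qed.

Lemma smooth_on_linear (W W' : normedModType R) (l : {linear W -> W'}) U
    (f : 'rV[R]_d -> W) : continuous l -> open U -> smooth_on U f ->
  smooth_on U (l \o f).
Proof.
move=> lc oU sf; have [cf df] := sf.
apply: (@smooth_on_of_eq_on _ _ _ (fun s => l \o pderivs s f)) => //.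
- by move=> s x Ux; exact: (pderivs_linear s lc oU sf).
- by move=> s x Ux; apply: continuous_comp; [exact: cf|exact: lc].
- by move=> s i x Ux; have [] := is_derive_linear lc (df s i x Ux).
Qed.

Lemma pderivC_real U (f : 'rV[R]_d -> R) i j : open U -> smooth_on U f ->
  forall x, U x -> pderiv i (pderiv j f) x = pderiv j (pderiv i f) x.
Proof.
move=> oU [cf df] x Ux; apply: (@schwarz_real _ _ U) => //.
- by move=> y Uy; split; exact: (df [::]).
- by move=> y Uy; split; [exact: (df [:: j])|exact: (df [:: i])].
- exact: (cf [:: i; j]).
- exact: (cf [:: j; i]).
Qed.

(** The mean value theorem fails for complex values, so symmetry is transferred
    through the real and imaginary parts. *)
Lemma pderivC U (f : 'rV[R]_d -> Rcomplex R) i j : open U -> smooth_on U f ->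
  forall x, U x -> pderiv i (pderiv j f) x = pderiv j (pderiv i f) x.
Proof.
move=> oU sf x Ux.
have part (l : {linear Rcomplex R -> R}) : continuous l ->
    l (pderiv i (pderiv j f) x) = l (pderiv j (pderiv i f) x).
  move=> lc; have lE t := pderivs_linear t lc oU sf Ux.
  have := pderivC_real i j oU (smooth_on_linear lc oU sf) Ux.
  by rewrite [LHS](lE [:: i; j]) [RHS](lE [:: j; i]).
have reE := part (@complex.Re R) Re_continuous.
have imE := part (@complex.Im R) Im_continuous.
move: reE imE; case: (pderiv i _ x) => a b; case: (pderiv j _ x) => a' b' /=.
by move=> -> ->.
Qed.

(** By [pderivC] any letter can be moved to the front of a word, where it is
    matched with the first letter of the other word. *)
Lemma pderivs_perm U (f : 'rV[R]_d -> Rcomplex R) s t : open U ->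
  smooth_on U f -> perm_eq s t ->
  forall x, U x -> pderivs s f x = pderivs t f x.
Proof.
move=> oU sf.
have front i s1 s2 x : U x -> pderivs (s1 ++ i :: s2) f x =
    pderiv i (pderivs (s1 ++ s2) f) x.
  elim: s1 x => //= j s1 IH x Ux.
  rewrite (@pderivC U)//; last exact: smooth_on_pderivs.
  exact: (@pderivs_eq_on _ _ _ _ [:: j] oU IH).
elim: s t => [|i s IH] t.
  by rewrite perm_sym => /perm_nilP ->.
move=> st; have : i \in t by rewrite -(perm_mem st) mem_head.
move=> /splitPr t12; case: t12 st => t1 t2 st x Ux.
have st' : perm_eq s (t1 ++ t2).
  rewrite -(perm_cons i) (perm_trans st)// -(cat1s i t2) -(cat1s i (t1 ++ t2)).
  by rewrite perm_catCA.
rewrite front//; exact: (pderivs_eq_on [:: i] oU (IH _ st') Ux).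
Qed.

Lemma is_derive_bigsum (V W : normedModType R) (I : Type) (r : seq I)
    (F : I -> V -> W) (dF : I -> W) x v :
  (forall k, is_derive x v (F k) (dF k)) ->
  is_derive x v (fun y => \sum_(k <- r) F k y) (\sum_(k <- r) dF k).
Proof.
move=> hF; elim: r => [|k r IH].
  under eq_fun do rewrite big_nil; rewrite big_nil; exact: is_derive_cst.
under eq_fun do rewrite big_cons; rewrite big_cons; exact: is_deriveD.
Qed.

Lemma continuous_bigsum (T : topologicalType) (W : normedModType R)
    (I : Type) (r : seq I) (F : I -> T -> W) x :
  (forall k, {for x, continuous (F k)}) ->
  {for x, continuous (fun y => \sum_(k <- r) F k y)}.
Proof.
move=> cF; elim: r => [|k r IH]; rewrite /prop_for /continuous_at.
  by under eq_fun do rewrite big_nil; rewrite big_nil; exact: cvg_cst.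
under eq_fun do rewrite big_cons; rewrite big_cons.
by apply: cvgD IH; exact: cF.
Qed.

(** Distributing positions rather than letters, with repetition, makes all
    coefficients in Leibniz' rule equal to 1. *)
Fixpoint splits s : seq (seq 'I_d * seq 'I_d) :=
  if s is i :: s' then
    [seq (i :: p.1, p.2) | p <- splits s'] ++
    [seq (p.1, i :: p.2) | p <- splits s']
  else [:: ([::], [::])].

Lemma size_splits s : size (splits s) = (2 ^ size s)%N.
Proof.
elim: s => //= i s IH.
by rewrite size_cat !size_map IH expnS mul2n addnn.
Qed.

Lemma size_mem_splits s p :
  p \in splits s -> (size p.1 + size p.2 = size s)%N.
Proof.
elim: s p => [|i s IH] p /=; first by rewrite inE => /eqP ->.
by rewrite mem_cat => /orP[] /mapP[q /IH qs ->] /=; rewrite ?addSn ?addnS qs.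
Qed.

Section Leibniz.
Variables (U : set 'rV[R]_d) (f g : 'rV[R]_d -> Rcomplex R).
Hypotheses (oU : open U) (sf : smooth_on U f) (sg : smooth_on U g).

Let summand (p : seq 'I_d * seq 'I_d) x : Rcomplex R :=
  pderivs p.1 f x * pderivs p.2 g x.

Let is_derive_summand p i x : U x ->
  is_derive x (delta_mx 0 i : 'rV[R]_d) (summand p)
    (summand (i :: p.1, p.2) x + summand (p.1, i :: p.2) x).
Proof.
by move=> Ux; apply: is_derive_RcomplexM;
  [exact: sg.1|exact: sf.2|exact: sg.2].
Qed.

Lemma leibniz s x : U x ->
  pderivs s (fun y => f y * g y : Rcomplex R) x =
  \sum_(p <- splits s) pderivs p.1 f x * pderivs p.2 g x.
Proof.
elim: s x => [|i s IH] x Ux; first by rewrite big_seq1.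
transitivity (pderiv i (fun y => \sum_(p <- splits s) summand p y) x).
  exact: (@pderivs_eq_on _ _ _ _ [:: i] oU IH).
have [_ sumE] := is_derive_bigsum (splits s) (fun p => is_derive_summand p i Ux).
by rewrite /pderiv sumE big_split /= big_cat !big_map.
Qed.

Lemma smooth_on_mul : smooth_on U (fun y => f y * g y : Rcomplex R).
Proof.
apply: (smooth_on_of_eq_on (F := fun s x => \sum_(p <- splits s) summand p x)) => //.
- exact: leibniz.
- move=> s x Ux; apply: continuous_bigsum => p.
  exact: (Rcomplex_cvgM (sf.1 p.1 x Ux) (sg.1 p.2 x Ux)).
- move=> s i x Ux.
  by have [] := is_derive_bigsum (splits s) (fun p => is_derive_summand p i Ux).
Qed.

End Leibniz.

End IteratedPartials.

(** * Bounds along words and the two classes *)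

Section WordBounds.
Context {R : realType} {d : nat}.
Implicit Types (U K : set 'rV[R]_d) (f g : 'rV[R]_d -> Rcomplex R).
Implicit Types (s : seq 'I_d) (tau sigma h : R).

(** The word along which [mderiv a] differentiates. *)
Definition mindex_word (a : 'I_d -> nat) : seq 'I_d :=
  flatten [seq nseq (a i) i | i <- enum 'I_d].

Lemma size_mindex_word a : size (mindex_word a) = mlength a.
Proof.
rewrite /mindex_word size_flatten /shape -map_comp sumnE big_map /mlength big_enum /=.
by apply: eq_bigr => i _; rewrite size_nseq.
Qed.

Lemma count_mem_mindex_word a j : count_mem j (mindex_word a) = a j.
Proof.
rewrite /mindex_word count_flatten -map_comp sumnE big_map big_enum /= (bigD1 j)//=.
rewrite count_nseq /= eqxx mul1n big1 ?addn0// => i ij.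
by rewrite count_nseq /= (negbTE ij).
Qed.

Lemma perm_mindex_word s : perm_eq s (mindex_word (fun i => count_mem i s)).
Proof. by apply/allP => j _ /=; rewrite count_mem_mindex_word. Qed.

Definition word_bounded tau sigma h K f : Prop :=
  exists2 C : R, 0 <= C & forall s x, K x ->
    `|pderivs s f x| <= C * ultra_weight tau sigma h (size s).

(** Every word is a permutation of the word of a multi-index of the same
    length, so the bounds for multi-indices give those for all words. *)
Lemma ultra_norm_lty U K f tau sigma h : open U -> smooth_on U f -> K `<=` U ->
  sigma != 0 -> 0 < h ->
  (ultra_norm tau sigma h K f < +oo)%E <-> word_bounded tau sigma h K f.
Proof.
move=> oU sf KU s0 h0.
have W0 n := ultra_weight_gt0 tau n s0 h0.
split=> [fin|[C C0 fC]]; last first.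
  apply: (@le_lt_trans _ _ C%:E); last exact: ltry.
  apply: ge_ereal_sup => _ [a _ [x Kx <-]].
  by rewrite lee_fin ler_pdivrMr// -size_mindex_word; exact: fC.
have ub s x : K x ->
    ((`|pderivs s f x| / ultra_weight tau sigma h (size s))%:E <=
     ultra_norm tau sigma h K f)%E.
  move=> Kx; apply: ereal_sup_ubound.
  exists (fun i => count_mem i s) => //; exists x => //.
  have sw := perm_mindex_word s.
  rewrite -size_mindex_word -(perm_size sw); congr (`|_| / _)%:E.
  exact/esym/(pderivs_perm oU sf sw)/KU.
case E : (ultra_norm tau sigma h K f) fin ub => [C||] // _ ub.
  exists `|C| => // s x Kx; rewrite -ler_pdivrMr//.
  by have := ub s x Kx; rewrite lee_fin => /le_trans; apply; exact: ler_norm.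
(* the supremum is -oo: there is no x in K *)
by exists 0 => // s x Kx; have := ub s x Kx.
Qed.

Lemma word_bounded_le K f tau sigma h h' : 0 <= h -> h <= h' ->
  word_bounded tau sigma h K f -> word_bounded tau sigma h' K f.
Proof.
move=> h0 hh' [C C0 fC]; exists C => // s x Kx; apply: le_trans (fC s x Kx) _.
by rewrite ler_wpM2l// ultra_weight_le.
Qed.

(** The weight inequality with its factor 2^n pays for the 2^n terms of
    Leibniz' rule. *)
Lemma word_boundedM U K f g tau sigma h : open U -> smooth_on U f ->
  smooth_on U g -> K `<=` U -> 0 <= tau -> 1 <= sigma -> 0 < h ->
  word_bounded tau sigma h K f -> word_bounded tau sigma h K g ->
  word_bounded tau sigma (2 * max_powR (2 `^ (- sigma)) 1 h) K
    (fun x => f x * g x).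
Proof.
move=> oU sf sg KU t0 s1 h0 [A A0 fA] [B B0 gB].
exists (A * B) => [|s x Kx]; first exact: mulr_ge0.
rewrite (leibniz oU sf sg)//; last exact: KU.
apply: (le_trans (ler_norm_sum _ _ _)).
set W := ultra_weight _ _ _ (size s).
have term p : p \in splits s ->
    `|pderivs p.1 f x * pderivs p.2 g x : Rcomplex R| <=
    A * B * (W / 2 ^+ size s).
  move=> ps; rewrite Rcomplex_normM.
  apply: (le_trans (ler_pM _ _ (fA _ _ Kx) (gB _ _ Kx))) => //.
  rewrite mulrACA ler_wpM2l ?mulr_ge0// ler_pdivlMr ?exprn_gt0// mulrC.
  by rewrite /W -(size_mem_splits ps) ultra_weightM.
rewrite big_seq; apply: (le_trans (ler_sum _ term)); rewrite -big_seq.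
rewrite big_const_seq count_predT size_splits iter_addr_0 -[leLHS]mulr_natr.
by rewrite natrX -(mulrA (A * B)) divfK ?expf_neq0.
Qed.

Lemma word_bounded_pderiv K f i tau sigma h : 0 <= tau -> 0 < sigma -> 0 < h ->
  word_bounded tau sigma h K f ->
  word_bounded tau sigma (shift_factor tau sigma * max_powR 1 (2 `^ sigma) h) K
    (pderiv i f).
Proof.
move=> t0 s0 h0 [C C0 fC].
exists (C * Num.max 1 h) => [|s x Kx].
  by rewrite mulr_ge0// le_max ler01.
rewrite -[pderiv i f]/(pderivs [:: i] f) -pderivs_cat.
apply: (le_trans (fC _ _ Kx)).
by rewrite size_cat addn1 -mulrA ler_wpM2l// ultra_weightS.
Qed.

Lemma roumieuP U tau sigma f : open U -> sigma != 0 ->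
  roumieu tau sigma U f <-> smooth_on U f /\
  forall K, compact K -> K `<=` U ->
    exists2 h, 0 < h & word_bounded tau sigma h K f.
Proof.
move=> oU s0; split=> -[sf fK]; split=> // K cK KU; have [h h0 hK] := fK K cK KU;
  by exists h => //; apply/(ultra_norm_lty tau oU sf KU s0 h0).
Qed.

Lemma beurlingP U tau sigma f : open U -> sigma != 0 ->
  beurling tau sigma U f <-> smooth_on U f /\
  forall K, compact K -> K `<=` U ->
    forall h, 0 < h -> word_bounded tau sigma h K f.
Proof.
move=> oU s0; split=> -[sf fK]; split=> // K cK KU h h0;
  by apply/(ultra_norm_lty tau oU sf KU s0 h0)/fK.
Qed.

(** In the Roumieu case the two factors first get a common parameter, the larger
    one; in the Beurling case the parameter for the factors is chosen small
    enough for the target. *)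
Lemma class_mul U tau sigma (E : set ('rV[R]_d -> Rcomplex R)) f g :
  open U -> 0 < tau -> 1 < sigma ->
  E = roumieu tau sigma U \/ E = beurling tau sigma U ->
  E f -> E g -> E (fun x => f x * g x).
Proof.
move=> oU t0 s1; have s0 : sigma != 0 by rewrite gt_eqF// (lt_trans ltr01).
have t0' := ltW t0; have s1' := ltW s1.
move=> [] ->.
  move=> /roumieuP-/(_ oU s0)[sf fK] /roumieuP-/(_ oU s0)[sg gK].
  apply/roumieuP => //; split=> [|K cK KU]; first exact: smooth_on_mul.
  have [[h h0 fh] [k k0 gk]] := (fK K cK KU, gK K cK KU).
  have m0 : 0 < Num.max h k by rewrite lt_max h0.
  exists (2 * max_powR (2 `^ (- sigma)) 1 (Num.max h k)).
    by rewrite mulr_gt0// max_powR_gt0.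
  apply: (word_boundedM oU) => //.
    by apply: word_bounded_le fh; [exact: ltW|rewrite le_max lexx].
  by apply: word_bounded_le gk; [exact: ltW|rewrite le_max lexx orbT].
move=> /beurlingP-/(_ oU s0)[sf fK] /beurlingP-/(_ oU s0)[sg gK].
apply/beurlingP => //; split=> [|K cK KU h h0]; first exact: smooth_on_mul.
have c1 : (0 : R) < 2 `^ (- sigma) <= 1.
  rewrite powR_gt0//= -[leRHS](powRr0 (2 : R)) ler_powR ?ler1n//.
  by rewrite oppr_le0 ltW// (lt_trans ltr01).
have [k k0 kh] := max_powR_small c1 (ltr0Sn R 1) h0.
apply: word_bounded_le kh _; first by rewrite mulr_ge0// max_powR_ge0.
by apply: (word_boundedM oU) => //; [exact: fK|exact: gK].
Qed.

Lemma class_pderiv U tau sigma (E : set ('rV[R]_d -> Rcomplex R)) i f :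
  open U -> 0 < tau -> 1 < sigma ->
  E = roumieu tau sigma U \/ E = beurling tau sigma U ->
  E f -> E (pderiv i f).
Proof.
move=> oU t0 s1; have s0' : 0 < sigma := lt_trans ltr01 s1.
have s0 : sigma != 0 by rewrite gt_eqF.
have t0' := ltW t0.
have B0 : 0 < shift_factor tau sigma by exact: expR_gt0.
move=> [] ->.
  move=> /roumieuP-/(_ oU s0)[sf fK]; apply/roumieuP => //.
  split=> [|K cK KU]; first exact: (@smooth_on_pderivs _ _ _ _ [:: i]).
  have [h h0 fh] := fK K cK KU.
  exists (shift_factor tau sigma * max_powR 1 (2 `^ sigma) h).
    by rewrite mulr_gt0// max_powR_gt0.
  exact: word_bounded_pderiv.
move=> /beurlingP-/(_ oU s0)[sf fK]; apply/beurlingP => //.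
split=> [|K cK KU h h0]; first exact: (@smooth_on_pderivs _ _ _ _ [:: i]).
have c1 : (0 : R) < 1 <= 2 `^ sigma.
  by rewrite ltr01 -[leLHS](powRr0 (2 : R)) ler_powR ?ler1n// ltW.
have [k k0 kh] := max_powR_small c1 B0 h0.
apply: word_bounded_le kh _; first by rewrite mulr_ge0 ?max_powR_ge0 ?ltW.
by apply: word_bounded_pderiv => //; exact: fK.
Qed.

End WordBounds.

Theorem theorem2p1 (R : realType) (d : nat) (U : set 'rV[R]_d) (tau sigma : R)
    (E : set ('rV[R]_d -> Rcomplex R)) :
  open U -> 0 < tau -> 1 < sigma ->
  E = roumieu tau sigma U \/ E = beurling tau sigma U ->
  (forall phi psi : 'rV[R]_d -> Rcomplex R,
     E phi -> E psi -> E (fun x => phi x * psi x)) /\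
  (forall (beta : 'I_d -> nat) (phi : 'rV[R]_d -> Rcomplex R),
     E phi -> E (mderiv beta phi)).
Proof.
move=> oU t0 s1 hE; split=> [phi psi|beta phi Ephi];
  first exact: (class_mul oU t0 s1 hE).
rewrite /mderiv; elim: (flatten _) => [//|i s IH].
exact: (@class_pderiv _ _ _ _ _ _ i _ oU t0 s1 hE IH).
Qed.
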